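(* Let $\mathcal{M}$ be a unitary magma and let $$f=\sum_{\mathfrak{p}\in\mathcal{T}_{\mathcal{M}}}\lambda_{\mathfrak{p}}\,\mathfrak{p}$$ be an element of $\mathsf{C}\mathcal{M}(2)$, where the $\lambda_{\mathfrak{p}}$ are coefficients in $\mathbb{K}$. Write $\lambda(a;b,c)$ for the coefficient of the $\mathcal{M}$-triangle $T(a;b,c)$ with base label $a$, first edge label $b$ and second edge label $c$. Then $f$ is associative (that is, $f\circ_1f=f\circ_2f$) if and only if the following three families of equations hold: $$\sum_{\substack{\mathfrak{p}_1,\mathfrak{q}_0\in\mathcal{M}\\ \mathfrak{p}_1\star\mathfrak{q}_0=\delta}}\lambda(\mathfrak{p}_0;\mathfrak{p}_1,\mathfrak{p}_2)\,\lambda(\mathfrak{q}_0;\mathfrak{q}_1,\mathfrak{q}_2)=0\quad\text{for all }\mathfrak{p}_0,\mathfrak{p}_2,\mathfrak{q}_1,\mathfrak{q}_2\in\mathcal{M},\ \delta\in\mathcal{M}\setminus\{\mathds{1}_{\mathcal{M}}\};$$ $$\sum_{\substack{\mathfrak{p}_1,\mathfrak{q}_0\in\mathcal{M}\\ \mathfrak{p}_1\star\mathfrak{q}_0=\mathds{1}_{\mathcal{M}}}}\Big(\lambda(\mathfrak{p}_0;\mathfrak{p}_1,\mathfrak{p}_2)\,\lambda(\mathfrak{q}_0;\mathfrak{q}_1,\mathfrak{q}_2)-\lambda(\mathfrak{p}_0;\mathfrak{q}_1,\mathfrak{p}_1)\,\lambda(\mathfrak{q}_0;\mathfrak{q}_2,\mathfrak{p}_2)\Big)=0\quad\text{for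 all }\mathfrak{p}_0,\mathfrak{p}_2,\mathfrak{q}_1,\mathfrak{q}_2\in\mathcal{M};$$ $$\sum_{\substack{\mathfrak{p}_2,\mathfrak{q}_0\in\mathcal{M}\\ \mathfrak{p}_2\star\mathfrak{q}_0=\delta}}\lambda(\mathfrak{p}_0;\mathfrak{p}_1,\mathfrak{p}_2)\,\lambda(\mathfrak{q}_0;\mathfrak{q}_1,\mathfrak{q}_2)=0\quad\text{for all }\mathfrak{p}_0,\mathfrak{p}_1,\mathfrak{q}_1,\mathfrak{q}_2\in\mathcal{M},\ \delta\in\mathcal{M}\setminus\{\mathds{1}_{\mathcal{M}}\}.$$
   Context: All vector spaces are over a field $\mathbb{K}$ of characteristic zero; $[n]=\{1,\dots,n\}$. A unitary magma is a set $\mathcal{M}$ with a binary operation $\star$ (not necessarily associative) having a two-sided unit $\mathds{1}_{\mathcal{M}}$. An $\mathcal{M}$-clique $\mathfrak{p}$ of arity $n\ge1$ is a map assigning to every arc $(x,y)$, $1\le x<y\le n+1$, a label $\mathfrak{p}(x,y)\in\mathcal{M}$; by convention, the only $\mathcal{M}$-clique of arity $1$ is the one with $\mathfrak{p}(1,2)=\mathds{1}_{\mathcal{M}}$. Put $\mathfrak{p}_0:=\mathfrak{p}(1,n+1)$ (label of the base) and $\mathfrak{p}_i:=\mathfrak{p}(i,i+1)$ for $i\in[n]$ (label of the $i$th edge). $\mathsf{C}\mathcal{M}$ is the (nonsymmetric) operad whose space $\mathsf{C}\mathcal{M}(n)$ is the linear span of all $\mathcal{M}$-cliques of arity $n$,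 whose unit is the unique $\mathcal{M}$-clique of arity $1$, and where, for $\mathcal{M}$-cliques $\mathfrak{p},\mathfrak{q}$ of arities $n,m$ and $i\in[n]$, $\mathfrak{p}\circ_i\mathfrak{q}$ is the $\mathcal{M}$-clique of arity $n+m-1$ with $$(\mathfrak{p}\circ_i\mathfrak{q})(x,y)=\begin{cases}\mathfrak{p}(x,y)&\text{if }y\le i,\\ \mathfrak{p}(x,y-m+1)&\text{if }x\le i<i+m\le y,\ (x,y)\ne(i,i+m),\\ \mathfrak{p}(x-m+1,y-m+1)&\text{if }i+m\le x,\\ \mathfrak{q}(x-i+1,y-i+1)&\text{if }i\le x<y\le i+m,\ (x,y)\ne(i,i+m),\\ \mathfrak{p}_i\star\mathfrak{q}_0&\text{if }(x,y)=(i,i+m),\\ \mathds{1}_{\mathcal{M}}&\text{otherwise.}\end{cases}$$ $\mathcal{T}_{\mathcal{M}}$ is the set of $\mathcal{M}$-triangles, i.e. $\mathcal{M}$-cliques of arity $2$; $T(a;b,c)$ denotes the $\mathcal{M}$-triangle $\mathfrak{p}$ with $\mathfrak{p}_0=a$, $\mathfrak{p}_1=b$, $\mathfrak{p}_2=c$. As $f$ is an element of the linear span of $\mathcal{T}_{\mathcal{M}}$, only finitely many $\lambda_{\mathfrak{p}}$ are nonzero. *)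

(* Defs.v *)
From HB Require Import structures.
From mathcomp Require Import all_boot all_order all_algebra finmap monalg.
From mathcomp.classical Require Import boolp classical_sets fsbigop.

Set Implicit Arguments.
Unset Strict Implicit.
Unset Printing Implicit Defensive.

Import GRing.Theory.

Local Open Scope ring_scope.

(* Vertices are numbered from 1 to n + 1: the element 0 of 'I_n.+2 is not the
   endpoint of any arc. *)
Record arc (n : nat) : predArgType := Arc {
  arc_ends :> 'I_n.+2 * 'I_n.+2;
  _ : (0 < arc_ends.1 < arc_ends.2)%N
}.
HB.instance Definition _ n := [isSub for @arc_ends n].
HB.instance Definition _ n := [Finite of arc n by <:].

Section Cliques.
Variable M : umagmaType.

Definition clique_axiom (n : nat) (p : {ffun arc n -> M}) : bool :=
  (n == 1)%N ==> [forall a, p a == 1%g].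

(* Only n >= 1 is meaningful. *)
Record clique (n : nat) : predArgType := Clique {
  clique_fun :> {ffun arc n -> M};
  _ : clique_axiom clique_fun
}.
HB.instance Definition _ n := [isSub for @clique_fun n].
HB.instance Definition _ n := [Choice of clique n by <:].

(* The label p(x, y); the unit of M when (x, y) is not an arc. inord sends
   naturals above n + 1 to 0, so insub rejects them too. *)
Definition label (n : nat) (p : clique n) (x y : nat) : M :=
  oapp p 1%g (insub (inord x, inord y) : option (arc n)).

Definition base (n : nat) (p : clique n) : M := label p 1 n.+1.
Definition edge (n : nat) (p : clique n) (i : nat) : M := label p i i.+1.

Definition of_labels (n : nat) (F : nat -> nat -> M) : {ffun arc n -> M} :=
  [ffun a : arc n => F a.1 a.2].

Lemma triangle_subproof (F : nat -> nat -> M) : clique_axiom (of_labels 2 F).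
Proof. by []. Qed.

(* T(a; b, c): base label a, edge labels b and c. *)
Definition triangle (a b c : M) : clique 2 :=
  Clique (triangle_subproof (fun x y =>
    if (x == 1)%N && (y == 3)%N then a else if (x == 1)%N then b else c)).

Definition comp_label (n m : nat) (p : clique n) (i : nat) (q : clique m)
    (x y : nat) : M :=
  let is_diag := (x == i) && (y == i + m)%N in
  if (y <= i)%N then label p x y
  else if [&& x <= i, i + m <= y & ~~ is_diag]%N then label p x (y - m + 1)
  else if (i + m <= x)%N then label p (x - m + 1) (y - m + 1)
  else if [&& i <= x, y <= i + m & ~~ is_diag]%N
    then label q (x - i + 1) (y - i + 1)
  else if is_diag then (edge p i * base q)%g
  else 1%g.

Lemma label_arity1 (p : clique 1) (x y : nat) : label p x y = 1%g.
Proof.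
rewrite /label; case: insub => //= a.
by case: p => p /= /forallP /(_ a) /eqP.
Qed.

Lemma comp_subproof (n m : nat) (p : clique n.+1) (i : nat) (q : clique m.+1) :
  clique_axiom (of_labels (n + m).+1 (comp_label p i q)).
Proof.
apply/implyP; rewrite eqSS addn_eq0 => /andP[/eqP n0 /eqP m0].
subst n m; apply/forallP => a; rewrite ffunE /comp_label /edge /base.
by rewrite !label_arity1 mulg1 !if_same.
Qed.

(* Arities are successors, hence positive, so that the arity n.+1 + m.+1 - 1 of
   p o_i q is (n + m).+1. The value is meaningful only for 1 <= i <= n.+1. *)
Definition clique_comp (n m : nat) (p : clique n.+1) (i : nat)
    (q : clique m.+1) : clique (n + m).+1 :=
  Clique (comp_subproof p i q).

Variable K : fieldType.

Definition CM (n : nat) : Type := {malg K[clique n]}.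

Definition CM_comp (n m : nat) (f : CM n.+1) (i : nat) (g : CM m.+1) :
    CM (n + m).+1 :=
  \sum_(p <- msupp f) \sum_(q <- msupp g)
    << f@_p * g@_q *g clique_comp p i q >>.

Definition is_associative (f : CM 2) : Prop := CM_comp f 1 f = CM_comp f 2 f.

Definition triangle_coef (f : CM 2) (a b c : M) : K := f@_(triangle a b c).

End Cliques.

Arguments CM M K n : clear implicits.

(* Main.v *)
Require Import Defs.
From mathcomp Require Import all_boot all_order all_algebra finmap monalg.
From mathcomp.classical Require Import boolp classical_sets fsbigop.
From mathcomp.classical Require Import cardinality.

(** Both sides of f o_1 f = f o_2 f are combinations of cliques of arity 3, so
    the equation can be compared coefficient by coefficient. A clique r of
    arity 3 is a labelled square with vertices 1, 2, 3, 4 and diagonals (1, 3)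
    and (2, 4). Composing two triangles at 1 glues them along (1, 3): four
    labels of the result are outer labels of the triangles, the diagonal (1, 3)
    carries the product of the two glued labels, and the diagonal (2, 4)
    carries the unit. Composing at 2 exchanges the roles of the diagonals.
    So the pairs of triangles whose composite at 1 is r exist only if r(2, 4)
    is the unit, and they are then parametrized by the pairs of elements of M
    with product r(1, 3) ([clique_comp1P], [mcoeff_comp1]); symmetrically at 2
    ([clique_comp2P], [mcoeff_comp2]).

    Equality of the coefficients of r splits according to which diagonals are
    labelled by the unit. If only (2, 4) is, the coefficient in f o_2 f
    vanishes and the first family remains; if only (1, 3) is, the third one
    does; if both are, the two sums are equal, which is the second family; if
    neither is, both coefficients are zero. Conversely, each choice of the
    parameters of a family is read off some square, since any label delta of a
    diagonal is the product of delta and the unit.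

    The sums may range over infinite sets when M is infinite. They have finite
    support because f has, and a pair of factors determines the pair of
    elements of M that indexes it ([finite_coef_support]); this is what allows
    the sum of differences in the second family to be split. *)

Import GRing.Theory.

Local Open Scope classical_set_scope.
Local Open Scope ring_scope.

(** * Sums of finite support *)

(** Finiteness of both supports cannot be dropped: a sum of infinite support
    has the value 0 by convention, also when the differences cancel down to a
    finite nonzero sum. *)
Lemma fsumrB {V : zmodType} {I : choiceType} (A : set I) (F G : I -> V) :
    finite_set (A `&` F @^-1` [set~ 0]) ->
    finite_set (A `&` G @^-1` [set~ 0]) ->
  \sum_(i \in A) (F i - G i) = \sum_(i \in A) F i - \sum_(i \in A) G i.
Proof.
move=> finF finG.
pose S := (A `&` F @^-1` [set~ 0]) `|` (A `&` G @^-1` [set~ 0]).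
have SA : S `<=` A by move=> i [[]|[]].
have finS : finite_set S by rewrite finite_setU.
have F0 i : (A `\` S) i -> F i = 0.
  by move=> [Ai nSi]; apply: contrapT => Fi; apply: nSi; left.
have G0 i : (A `\` S) i -> G i = 0.
  by move=> [Ai nSi]; apply: contrapT => Gi; apply: nSi; right.
rewrite -(fsbig_widen _ _ _ SA); last by move=> i Si /=; rewrite F0 ?G0 ?subr0.
rewrite -(fsbig_widen _ _ F SA) -?(fsbig_widen _ _ G SA); [|exact: G0|exact: F0].
by rewrite !(fsbig_finite _ _ finS) sumrB.
Qed.

(** * Labels of cliques and of composites of triangles *)

Section Labels.
Context {M : umagmaType}.

Lemma label_of_labels {n : nat} {F : nat -> nat -> M}
    (Fn : clique_axiom (of_labels n F)) (x y : nat) :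
  (0 < x < y)%N -> (y <= n.+1)%N -> label (Clique Fn) x y = F x y.
Proof.
move=> xy yn; have /andP[_ xlty] := xy.
have xn : (x <= n.+1)%N by exact: leq_trans (ltnW xlty) yn.
rewrite /label (@insubT _ _ _ (inord x, inord y)) /= ?inordK// => xyn.
by rewrite ffunE /= !inordK.
Qed.

(** Specialized to triangles with the arity of the composite written as a
    numeral, which rewriting does not identify with the sum of arities. *)
Lemma label_clique_comp (p q : clique M 2) (i x y : nat) :
    (0 < x < y)%N -> (y <= 4)%N ->
  @label M 3 (clique_comp p i q) x y = comp_label p i q x y.
Proof. exact: label_of_labels. Qed.

Lemma eq_clique {n : nat} (p q : clique M n) :
  (forall x y, (0 < x < y)%N -> (y <= n.+1)%N -> label p x y = label q x y) ->
  p = q.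
Proof.
move=> pq; apply/val_inj/ffunP => -[[x y] xy] /=.
have := pq x y xy (ltn_ord y).
by rewrite /label !inord_val insubT.
Qed.

Lemma eq_triangle (p q : clique M 2) :
    label p 1 3 = label q 1 3 -> label p 1 2 = label q 1 2 ->
    label p 2 3 = label q 2 3 ->
  p = q.
Proof.
move=> e13 e12 e23; apply: eq_clique.
by move=> [|[|[|[|x]]]] [|[|[|[|y]]]].
Qed.

Lemma eq_clique3 (p q : clique M 3) :
    label p 1 2 = label q 1 2 -> label p 1 3 = label q 1 3 ->
    label p 1 4 = label q 1 4 -> label p 2 3 = label q 2 3 ->
    label p 2 4 = label q 2 4 -> label p 3 4 = label q 3 4 ->
  p = q.
Proof.
move=> e12 e13 e14 e23 e24 e34; apply: eq_clique.
by move=> [|[|[|[|[|x]]]]] [|[|[|[|[|y]]]]].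
Qed.

Lemma label_triangle (a b c : M) :
  (label (triangle a b c) 1 3 = a) * (label (triangle a b c) 1 2 = b) *
  (label (triangle a b c) 2 3 = c).
Proof. by rewrite !label_of_labels. Qed.

(** The factors of r at 1 are determined by r up to the two labels that are
    glued together: every other label of p and q is copied to a side of r, and
    the diagonal (2, 4) crosses the gluing arc, hence carries the unit. *)
Lemma clique_comp1P (p q : clique M 2) (r : clique M 3) :
  clique_comp p 1 q = r <->
  [/\ label r 2 4 = 1%g, p = triangle (label r 1 4) (label p 1 2) (label r 3 4),
      q = triangle (label q 1 3) (label r 1 2) (label r 2 3)
    & (label p 1 2 * label q 1 3)%g = label r 1 3].
Proof.
split=> [<-|[r24 -> ->]].
  rewrite !label_clique_comp //; split=> //.
    by apply: eq_triangle; rewrite label_triangle.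
  by apply: eq_triangle; rewrite label_triangle.
rewrite !label_triangle => r13.
apply: eq_clique3; rewrite label_clique_comp // ?r24 // /comp_label /=.
all: rewrite /base /edge ?label_triangle //.
Qed.

(** The mirror image of [clique_comp1P]: the gluing arc is now (2, 4), and
    (1, 3) is the diagonal that crosses it. *)
Lemma clique_comp2P (p q : clique M 2) (r : clique M 3) :
  clique_comp p 2 q = r <->
  [/\ label r 1 3 = 1%g, p = triangle (label r 1 4) (label r 1 2) (label p 2 3),
      q = triangle (label q 1 3) (label r 2 3) (label r 3 4)
    & (label p 2 3 * label q 1 3)%g = label r 2 4].
Proof.
split=> [<-|[r13 -> ->]].
  rewrite !label_clique_comp //; split=> //.
    by apply: eq_triangle; rewrite label_triangle.
  by apply: eq_triangle; rewrite label_triangle.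
rewrite !label_triangle => r24.
apply: eq_clique3; rewrite label_clique_comp // ?r13 // /comp_label /=.
all: rewrite /base /edge ?label_triangle //.
Qed.
End Labels.

(** * Coefficients of composites *)

Section Coefficients.
Context {M : umagmaType} {K : fieldType}.

(** Summing over all pairs instead of the two supports makes the index set
    depend on r alone, so that it can be reparametrized. *)
Lemma mcoeff_comp {n m : nat} (f : CM M K n.+1) (i : nat) (g : CM M K m.+1)
    (r : clique M (n + m).+1) :
  (CM_comp f i g)@_r =
    \sum_(pq \in [set pq | clique_comp pq.1 i pq.2 = r]) f@_pq.1 * g@_pq.2.
Proof.
pose S := [seq (p, q) | p <- msupp f, q <- msupp g].
pose P pq := clique_comp pq.1 i pq.2 == r.
have -> : [set pq | clique_comp pq.1 i pq.2 = r] = [set` P].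
  by apply/seteqP; split=> pq /eqP.
rewrite -(@bigfs _ _ _ _ S P); last 2 first.
- by apply: allpairs_uniq; rewrite ?fset_uniq // => -[p q] [p' q'] _ _.
- move=> [p q] _ pqS /=; apply/eqP; rewrite mulf_eq0; apply: contraNT pqS.
  rewrite negb_or !mcoeff_neq0 => /andP[pf qg].
  by apply/allpairsP; exists (p, q).
rewrite big_mkcond big_allpairs raddf_sum; apply: eq_bigr => p _.
rewrite raddf_sum; apply: eq_bigr => q _.
by rewrite /= mcoeffU /P /=; case: eqP.
Qed.

(** Reparametrization common to the two compositions of triangles, where the
    factorizations of r form a family over the pairs of elements of M with a
    given product. *)
Lemma mcoeff_comp_param {n m : nat} (f : CM M K n.+1) (i : nat)
    (g : CM M K m.+1) (r : clique M (n + m).+1) {I : choiceType} (D : set I)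
    (h : I -> clique M n.+1 * clique M m.+1) :
    injective h ->
    (forall pq, clique_comp pq.1 i pq.2 = r <-> exists2 u, D u & h u = pq) ->
  (CM_comp f i g)@_r = \sum_(u \in D) f@_(h u).1 * g@_(h u).2.
Proof.
move=> hinj hP; rewrite mcoeff_comp; apply: reindex_fsbig; split.
- by move=> u Du; apply/hP; exists u.
- by move=> u v _ _; exact: hinj.
- by move=> pq /hP.
Qed.

(** The nonzero terms are indexed by the preimage under h of a product of two
    supports, and h is injective. *)
Lemma finite_coef_support {n m : nat} (f : CM M K n) (g : CM M K m)
    {I : choiceType} (D : set I) (h : I -> clique M n * clique M m) :
  injective h ->
  finite_set (D `&` (fun u => f@_(h u).1 * g@_(h u).2) @^-1` [set~ 0]).
Proof.
move=> hinj.
apply: (@sub_finite_set _ _ (h @^-1` ([set` msupp f] `*` [set` msupp g]))).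
  move=> u [_ /= /eqP]; rewrite mulf_eq0 negb_or !mcoeff_neq0 => /andP[] //.
apply: finite_preimage => [u v _ _|]; first exact: hinj.
by apply: finite_setX; exact: finite_fset.
Qed.

(** The pairs of triangles with prescribed labels outside the gluing arc of the
    composition at 1; u holds the two labels to be glued. *)
Definition comp1_factors (p0 p2 q1 q2 : M) (u : M * M) :
  clique M 2 * clique M 2 := (triangle p0 u.1 p2, triangle u.2 q1 q2).

Definition comp2_factors (p0 p1 q1 q2 : M) (u : M * M) :
  clique M 2 * clique M 2 := (triangle p0 p1 u.1, triangle u.2 q1 q2).

Lemma comp1_factors_inj (p0 p2 q1 q2 : M) :
  injective (comp1_factors p0 p2 q1 q2).
Proof.
apply: (can_inj (g := fun pq => (label pq.1 1 2, label pq.2 1 3))).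
by move=> [u1 u2]; rewrite /= !label_triangle.
Qed.

Lemma comp2_factors_inj (p0 p1 q1 q2 : M) :
  injective (comp2_factors p0 p1 q1 q2).
Proof.
apply: (can_inj (g := fun pq => (label pq.1 2 3, label pq.2 1 3))).
by move=> [u1 u2]; rewrite /= !label_triangle.
Qed.

Lemma mcoeff_comp1 (f g : CM M K 2) (r : clique M 3) :
  (CM_comp f 1 g : CM M K 3)@_r =
    if label r 2 4 == 1%g then
      \sum_(u \in [set u : M * M | (u.1 * u.2)%g = label r 1 3])
        (triangle_coef f (label r 1 4) u.1 (label r 3 4) *
         triangle_coef g u.2 (label r 1 2) (label r 2 3))
    else 0.
Proof.
case: eqP => r24.
  apply: (mcoeff_comp_param _ _ _ _ _ _ (comp1_factors_inj _ _ _ _)) => -[p q].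
  rewrite clique_comp1P; split=> /= [[_ -> ->]|[u r13 [<- <-]]].
    rewrite !label_triangle => r13.
    by exists (label p 1 2, label q 1 3).
  by rewrite !label_triangle.
rewrite (@mcoeff_comp 1 1) fsbig1 // => pq /clique_comp1P[].
by move/r24.
Qed.

Lemma mcoeff_comp2 (f g : CM M K 2) (r : clique M 3) :
  (CM_comp f 2 g : CM M K 3)@_r =
    if label r 1 3 == 1%g then
      \sum_(u \in [set u : M * M | (u.1 * u.2)%g = label r 2 4])
        (triangle_coef f (label r 1 4) (label r 1 2) u.1 *
         triangle_coef g u.2 (label r 2 3) (label r 3 4))
    else 0.
Proof.
case: eqP => r13.
  apply: (mcoeff_comp_param _ _ _ _ _ _ (comp2_factors_inj _ _ _ _)) => -[p q].
  rewrite clique_comp2P; split=> /= [[_ -> ->]|[u r24 [<- <-]]].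
    rewrite !label_triangle => r24.
    by exists (label p 2 3, label q 1 3).
  by rewrite !label_triangle.
rewrite (@mcoeff_comp 1 1) fsbig1 // => pq /clique_comp2P[].
by move/r13.
Qed.
End Coefficients.

(** * The associativity criterion *)

Theorem proposition2p2p4 (K : fieldType) (charK : [pchar K] =i pred0)
    (M : umagmaType) (f : CM M K 2) :
  is_associative f <->
  [/\ (forall p0 p2 q1 q2 delta : M, delta <> 1%g ->
         \sum_(u \in [set u : M * M | (u.1 * u.2)%g = delta])
           (triangle_coef f p0 u.1 p2 * triangle_coef f u.2 q1 q2) = 0),
      (forall p0 p2 q1 q2 : M,
         \sum_(u \in [set u : M * M | (u.1 * u.2)%g = 1%g])
           (triangle_coef f p0 u.1 p2 * triangle_coef f u.2 q1 q2
            - triangle_coef f p0 q1 u.1 * triangle_coef f u.2 q2 p2) = 0)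
    & (forall p0 p1 q1 q2 delta : M, delta <> 1%g ->
         \sum_(u \in [set u : M * M | (u.1 * u.2)%g = delta])
           (triangle_coef f p0 p1 u.1 * triangle_coef f u.2 q1 q2) = 0)].
Proof.
pose first_sum p0 p2 q1 q2 delta :=
  \sum_(u \in [set u : M * M | (u.1 * u.2)%g = delta])
     (triangle_coef f p0 u.1 p2 * triangle_coef f u.2 q1 q2).
pose second_sum p0 p1 q1 q2 delta :=
  \sum_(u \in [set u : M * M | (u.1 * u.2)%g = delta])
     (triangle_coef f p0 p1 u.1 * triangle_coef f u.2 q1 q2).
have unit_sumE p0 p2 q1 q2 :
    \sum_(u \in [set u : M * M | (u.1 * u.2)%g = 1%g])
      (triangle_coef f p0 u.1 p2 * triangle_coef f u.2 q1 q2
       - triangle_coef f p0 q1 u.1 * triangle_coef f u.2 q2 p2) =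
    first_sum p0 p2 q1 q2 1%g - second_sum p0 q1 q2 p2 1%g.
  apply: fsumrB.
    exact: finite_coef_support (comp1_factors_inj p0 p2 q1 q2).
  exact: finite_coef_support (comp2_factors_inj p0 q1 q2 p2).
have assocE : is_associative f <-> forall r : clique M 3,
    (if label r 2 4 == 1%g then first_sum (label r 1 4) (label r 3 4)
       (label r 1 2) (label r 2 3) (label r 1 3) else 0) =
    (if label r 1 3 == 1%g then second_sum (label r 1 4) (label r 1 2)
       (label r 2 3) (label r 3 4) (label r 2 4) else 0).
  split=> [ff r|ff]; first by rewrite -mcoeff_comp1 -mcoeff_comp2 ff.
  by apply/malgP => r; rewrite mcoeff_comp1 mcoeff_comp2.
rewrite assocE; split=> [ff|[first0 unit0 second0] r].
  have ff1 p0 p2 q1 q2 delta : first_sum p0 p2 q1 q2 delta =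
      if delta == 1%g then second_sum p0 q1 q2 p2 1%g else 0.
    (* The square with sides q1, q2, p2, base p0 and diagonals delta and 1,
       obtained by gluing delta to the unit. *)
    have := ff (clique_comp (triangle p0 delta p2) 1 (triangle 1%g q1 q2)).
    rewrite !label_clique_comp // /comp_label /= /base /edge !label_triangle.
    by rewrite mulg1 eqxx.
  have ff2 p0 p1 q1 q2 delta : second_sum p0 p1 q1 q2 delta =
      if delta == 1%g then first_sum p0 q2 p1 q1 1%g else 0.
    have := ff (clique_comp (triangle p0 p1 delta) 2 (triangle 1%g q1 q2)).
    rewrite !label_clique_comp // /comp_label /= /base /edge !label_triangle.
    by rewrite mulg1 eqxx.
  split=> [p0 p2 q1 q2 delta /eqP/negPf d1|p0 p2 q1 q2|].
  - by rewrite -/(first_sum _ _ _ _ _) ff1 d1.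
  - by rewrite unit_sumE ff1 eqxx subrr.
  - move=> p0 p1 q1 q2 delta /eqP/negPf d1.
    by rewrite -/(second_sum _ _ _ _ _) ff2 d1.
case: (eqVneq (label r 2 4) 1%g) => [r24|/eqP r24];
  case: (eqVneq (label r 1 3) 1%g) => [r13|/eqP r13] //.
- by rewrite r24 r13; apply/eqP; rewrite -subr_eq0 -unit_sumE unit0.
- exact: first0.
- exact/esym/second0.
Qed.
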